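(* Let $r\ge2$. The secrecy-based multivariate fidelity $F_S$ satisfies the following properties for all quantum states $\rho_1,\ldots,\rho_r$ on a common space. (i) (Reduction to classical) If $\rho_1,\ldots,\rho_r$ commute pairwise, then $F_S(\rho_1,\ldots,\rho_r)=\frac{2}{r(r-1)}\sum_{i<j}\sum_x\sqrt{\rho_i(x)\rho_j(x)}$, where $(\rho_i(x))_x$ are the eigenvalues of $\rho_i$ in a common eigenbasis. (ii) (Data processing) For every quantum channel $\mathcal N$, $F_S(\rho_1,\ldots,\rho_r)\le F_S(\mathcal N(\rho_1),\ldots,\mathcal N(\rho_r))$. (iii) (Symmetry) For every permutation $\pi$ of $\{1,\dots,r\}$, $F_S(\rho_1,\ldots,\rho_r)=F_S(\rho_{\pi(1)},\ldots,\rho_{\pi(r)})$. (iv) (Faithfulness) $F_S(\rho_1,\ldots,\rho_r)=1$ if and only if $\rho_i=\rho_j$ for all $i,j$. (v) (Orthogonality) $F_S(\rho_1,\ldots,\rho_r)=0$ if and only if $\rho_i\rho_j=0$ for all $i\ne j$. (vi) (Direct-sum property) For every finite alphabet $\mathcal X$, probability distribution $(p(x))_{x\in\mathcal X}$ and states $(\rho_i^x)_{x\in\mathcal X}$, $i=1,\dots,r$, $$F_S\Big(\sum_{x}p(x)|x\rangle\langle x|\otimes\rho_1^x,\ldots,\sum_{x}p(x)|x\rangle\langle x|\otimes\rho_r^x\Big)=\sum_{x}p(x)F_S(\rho_1^x,\ldots,\rho_r^x).$$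
   Context: All Hilbert spaces are finite-dimensional and complex. A quantum state is a positive semi-definite operator of unit trace; a quantum channel is a completely positive trace-preserving linear map (input and output dimensions may differ). $F(\rho,\sigma)=\|\sqrt\rho\sqrt\sigma\|_1$ is the Uhlmann fidelity. The secrecy measure is $S(\rho_1,\ldots,\rho_r)=\sup_{\sigma}\frac1r\sum_{i=1}^rF(\rho_i,\sigma)$, the supremum being over all states $\sigma$ on the same space, and the secrecy-based multivariate fidelity is $F_S(\rho_1,\ldots,\rho_r)=\frac{1}{r-1}\left(r\,S(\rho_1,\ldots,\rho_r)^2-1\right)$. $\{|x\rangle\}_{x\in\mathcal X}$ is an orthonormal basis of $\mathbb C^{|\mathcal X|}$. *)

(* Defs.v *)
From mathcomp Require Import all_boot all_order all_algebra.
From mathcomp Require Import boolp classical_sets reals.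
From mathcomp.real_closed Require Import complex mxtens.

Set Implicit Arguments.
Unset Strict Implicit.
Unset Printing Implicit Defensive.

Import Order.TTheory GRing.Theory Num.Theory.

Local Open Scope ring_scope.
Local Open Scope sesquilinear_scope.
Local Open Scope complex_scope.
Local Open Scope classical_set_scope.

Section Quantum.
Variable R : realType.
Local Notation C := R[i].

(* The order of R[i] makes [0 <= z] mean that z is real and nonnegative, so
   this condition forces A to be Hermitian. *)
Definition psdmx n (A : 'M[C]_n) : Prop :=
  forall v : 'cV[C]_n, 0 <= (v^t* *m A *m v) 0 0.

Definition is_state n (A : 'M[C]_n) : Prop := psdmx A /\ \tr A = 1.

(* Square root by functional calculus: for A normal, in particular positive
   semidefinite, A = invmx (spectralmx A) *m diag_mx (spectral_diag A)
   *m spectralmx A with spectralmx A unitary (orthomx_spectralP). *)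
Definition sqrtmx n (A : 'M[C]_n) : 'M[C]_n :=
  invmx (spectralmx A) *m diag_mx (map_mx sqrtC (spectral_diag A))
    *m spectralmx A.

(* The trace of |A| = sqrt(A^* A); it is real and [complex.Re] only casts it
   to R. *)
Definition trace_norm n (A : 'M[C]_n) : R := complex.Re (\tr (sqrtmx (A^t* *m A))).

Definition fidelity n (rho sigma : 'M[C]_n) : R :=
  trace_norm (sqrtmx rho *m sqrtmx sigma).

Definition secrecy r n (rho : 'I_r -> 'M[C]_n) : R :=
  sup [set r%:R^-1 * \sum_(i < r) fidelity (rho i) sigma |
       sigma in [set sigma : 'M[C]_n | is_state sigma]].

Definition secrecy_fidelity r n (rho : 'I_r -> 'M[C]_n) : R :=
  (r%:R - 1)^-1 * (r%:R * secrecy rho ^+ 2 - 1).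

(* The (i, j) block of X, an operator on C^k (x) C^n. *)
Definition tens_block k n (X : 'M[C]_(k * n)) (i j : 'I_k) : 'M[C]_n :=
  \matrix_(a, b) X (mxtens_index (i, a)) (mxtens_index (j, b)).

(* The map id_k (x) N. *)
Definition ampliation k n m (N : 'M[C]_n -> 'M[C]_m) (X : 'M[C]_(k * n)) :
    'M[C]_(k * m) :=
  \sum_(i < k) \sum_(j < k) (delta_mx i j : 'M[C]_k) *t N (tens_block X i j).

Definition completely_positive n m (N : 'M[C]_n -> 'M[C]_m) : Prop :=
  forall (k : nat) (X : 'M[C]_(k * n)), psdmx X -> psdmx (ampliation N X).

Definition trace_preserving n m (N : 'M[C]_n -> 'M[C]_m) : Prop :=
  forall A, \tr (N A) = \tr A.

Definition is_channel n m (N : {linear 'M[C]_n -> 'M[C]_m}) : Prop :=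
  completely_positive N /\ trace_preserving N.

(* The columns of U form an orthonormal basis and the x-th one is, for every i,
   an eigenvector of rho i with eigenvalue lam i x. *)
Definition common_eigenbasis r n (rho : 'I_r -> 'M[C]_n) (U : 'M[C]_n)
    (lam : 'I_r -> 'I_n -> R) : Prop :=
  U \is unitarymx /\
  forall i x, rho i *m col x U = (lam i x)%:C *: col x U.

Definition is_distribution (X : finType) (p : X -> R) : Prop :=
  (forall x, 0 <= p x) /\ \sum_x p x = 1.

(* |x><x| on C^|X|, the basis being indexed through enum_rank. *)
Definition basis_proj (X : finType) (x : X) : 'M[C]_#|X| :=
  delta_mx (enum_rank x) (enum_rank x).

Definition cq_state (X : finType) n (p : X -> R) (rho : X -> 'M[C]_n) :
    'M[C]_(#|X| * n) :=
  \sum_x (p x)%:C *: (basis_proj x *t rho x).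

End Quantum.

(* Main.v *)
Require Import Defs.
From mathcomp Require Import all_boot all_order all_algebra all_fingroup.
From mathcomp Require Import boolp classical_sets reals.
From mathcomp.real_closed Require Import complex mxtens.
From mathcomp Require Import ring lra.

Set Implicit Arguments.
Unset Strict Implicit.
Unset Printing Implicit Defensive.

Import Order.TTheory GRing.Theory Num.Theory.

Local Open Scope ring_scope.
Local Open Scope sesquilinear_scope.

(** Call P a subpurification of rho if P P^* <= rho.  Uhlmann's theorem, in the
    form proved here from singular values, says that F(rho, sigma) is the maximum
    of Re tr(P Q^* ) over subpurifications P of rho and Q of sigma, and that Q may
    be fixed to be the square root of sigma.  Applying it to all pairs
    (rho_i, sigma) with this common Q, and Cauchy-Schwarz, gives
      r^2 S^2 = sup || \sum_i P_i ||_2^2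
    over all families of subpurifications P_i of rho_i; conversely
    sigma = Q Q^* / || Q ||_2^2 with Q = \sum_i P_i attains the bound.
    Hence r^2 S^2 lies between \sum_(i, j) tr(sqrt rho_i sqrt rho_j) and
    \sum_(i, j) F(rho_i, rho_j).  The two ends agree for commuting states, and
    they also settle faithfulness and orthogonality.  For data processing, a
    channel maps the positive Gram block matrix (P_i P_j^* )_ij to a positive one,
    which is again the Gram matrix of subpurifications.  The direct-sum property
    follows by cutting the P_i into row blocks. *)

(** * Positive matrices and fidelity over an abstract closed field *)

Section ClosedField.
Variable C : numClosedFieldType.

Lemma adjmxM m n p (A : 'M[C]_(m, n)) (B : 'M[C]_(n, p)) :
  (A *m B)^t* = B^t* *m A^t*.
Proof. by rewrite trmx_mul map_mxM. Qed.

Lemma adjmxD m n (A B : 'M[C]_(m, n)) : (A + B)^t* = A^t* + B^t*.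
Proof. by rewrite linearD /= map_mxD. Qed.

Lemma adjmxB m n (A B : 'M[C]_(m, n)) : (A - B)^t* = A^t* - B^t*.
Proof. by rewrite linearB /= map_mxB. Qed.

Lemma adjmxZ m n a (A : 'M[C]_(m, n)) : (a *: A)^t* = a^* *: A^t*.
Proof. by rewrite linearZ /= map_mxZ. Qed.

Lemma adjmx_diag n (d : 'rV[C]_n) :
  (forall i, 0 <= d 0 i) -> (diag_mx d)^t* = diag_mx d.
Proof.
move=> d0; apply/matrixP => i j; rewrite !mxE eq_sym.
by case: eqP => [->|_]; rewrite ?mulr1n ?mulr0n ?rmorph0 // geC0_conj.
Qed.

Lemma unitarymxKV n (U : 'M[C]_n) : U \is unitarymx -> U^t* *m U = 1%:M.
Proof. by move=> Uu; rewrite -[X in X *m U]mul1mx mulmxKtV. Qed.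

Lemma unitarymxK n (U : 'M[C]_n) : U \is unitarymx -> U *m U^t* = 1%:M.
Proof. by move/unitarymxP. Qed.

Lemma quad_delta n (B : 'M[C]_n) i j :
  ((delta_mx i 0 : 'cV_n)^t* *m B *m (delta_mx j 0 : 'cV_n)) 0 0 = B i j.
Proof.
rewrite trmx_delta map_delta_mx -colE mxE.
rewrite (_ : delta_mx 0 i = delta_mx ord0 i) // -rowE.
by rewrite mxE.
Qed.

(** Polarization: testing on e_i + c e_j with c = 1 and c = i makes both B_ij + B_ji and B_ij - B_ji
    vanish. *)
Lemma quad_eq0 n (B : 'M[C]_n) :
  (forall v : 'cV_n, (v^t* *m B *m v) 0 0 = 0) -> B = 0.
Proof.
move=> B0; apply/matrixP => i j; rewrite [RHS]mxE.
have mxD00 (X Y : 'M[C]_1) : (X + Y) 0 0 = X 0 0 + Y 0 0 by rewrite mxE.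
have mxZ00 a (X : 'M[C]_1) : (a *: X) 0 0 = a * X 0 0 by rewrite mxE.
have E c : c * B i j + c^* * B j i = 0.
  have := B0 (delta_mx i 0 + c *: delta_mx j 0).
  rewrite adjmxD adjmxZ !mulmxDl !mulmxDr -!scalemxAl -!scalemxAr.
  rewrite !(mxD00, mxZ00) !B0 !quad_delta !mulr0 add0r addr0.
  by [].
have := E 1; rewrite rmorph1 !mul1r => /eqP; rewrite addr_eq0 => /eqP Bij.
have /eqP := E 'i; rewrite conjCi mulNr -mulrBr mulf_eq0.
have /negPf -> := neq0Ci C.
by rewrite Bij -opprD oppr_eq0 -mulr2n mulrn_eq0 /= => /eqP ->; rewrite oppr0.
Qed.

(* [posmx], [mxsqrt], [mxfid], [mxblk] and [cqmx] are the notions of Defs over an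
   abstract field, because over R[i] unification unfolds complex arithmetic. *)
Definition posmx n (A : 'M[C]_n) : Prop :=
  forall v : 'cV[C]_n, 0 <= (v^t* *m A *m v) 0 0.

(* Locked, as it is itself a product that rewriting with mulmxA would unfold. *)
Fact mxsqrt_key : unit. Proof. exact: tt. Qed.
Definition mxsqrt n (A : 'M[C]_n) : 'M[C]_n := locked_with mxsqrt_key
  (invmx (spectralmx A) *m diag_mx (map_mx sqrtC (spectral_diag A))
    *m spectralmx A).

Lemma posmxD n (A B : 'M[C]_n) : posmx A -> posmx B -> posmx (A + B).
Proof. by move=> Ap Bp v; rewrite mulmxDr mulmxDl mxE addr_ge0. Qed.

Lemma posmx0 n : posmx (0 : 'M[C]_n).
Proof. by move=> v; rewrite mulmx0 mul0mx mxE. Qed.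

Lemma posmxZ n (c : C) (A : 'M[C]_n) : 0 <= c -> posmx A -> posmx (c *: A).
Proof. by move=> c0 Ap v; rewrite -scalemxAr -scalemxAl mxE mulr_ge0. Qed.

Lemma posmx_conj m n (P : 'M[C]_(m, n)) (A : 'M[C]_n) :
  posmx A -> posmx (P *m A *m P^t* ).
Proof.
by move=> Ap v; have := Ap (P^t* *m v); rewrite adjmxM trmxCK !mulmxA.
Qed.

Lemma posmx1 n : posmx (1%:M : 'M[C]_n).
Proof.
move=> v; rewrite mulmx1 mxE sumr_ge0 // => i _.
by rewrite !mxE mulrC mul_conjC_ge0.
Qed.

Lemma posmx_gram m n (P : 'M[C]_(m, n)) : posmx (P *m P^t* ).
Proof. by rewrite -[P in P *m _]mulmx1; apply/posmx_conj/posmx1. Qed.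

(** The quadratic form of A takes real values, so that of A - A^* is zero and [quad_eq0] applies. *)
Lemma posmx_herm n (A : 'M[C]_n) : posmx A -> A^t* = A.
Proof.
move=> Ap; apply/esym/eqP; rewrite -subr_eq0; apply/eqP/quad_eq0 => v.
rewrite mulmxBr mulmxBl.
have -> : v^t* *m A^t* *m v = (v^t* *m A *m v)^t*.
  by rewrite !adjmxM trmxCK mulmxA.
by rewrite !mxE geC0_conj ?subrr //; have := Ap v; rewrite mxE.
Qed.

Lemma posmx_diag_ge0 n (A : 'M[C]_n) i : posmx A -> 0 <= A i i.
Proof. by move=> /(_ (delta_mx i 0)); rewrite quad_delta. Qed.

Lemma posmx_tr_ge0 n (A : 'M[C]_n) : posmx A -> 0 <= \tr A.
Proof. by move=> Ap; apply: sumr_ge0 => i _; apply: posmx_diag_ge0. Qed.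

Lemma posmx_diag_mx n (d : 'rV[C]_n) :
  (forall i, 0 <= d 0 i) -> posmx (diag_mx d).
Proof.
move=> d0 v; rewrite mxE sumr_ge0 // => i _.
rewrite mul_mx_diag !mxE mulrAC mulr_ge0 //.
by rewrite mulrC mul_conjC_ge0.
Qed.

Lemma posmx_unitary_diag n (U : 'M[C]_n) (d : 'rV[C]_n) :
  (forall i, 0 <= d 0 i) -> posmx (U^t* *m diag_mx d *m U).
Proof.
by move=> d0; have := posmx_conj (U^t* ) (posmx_diag_mx d0); rewrite trmxCK.
Qed.

Lemma posmx_spectral n (A : 'M[C]_n) : posmx A ->
  A = (spectralmx A)^t* *m diag_mx (spectral_diag A) *m spectralmx A /\
  forall i, 0 <= spectral_diag A 0 i.
Proof.
move=> Ap; set V := spectralmx A; set d := spectral_diag A.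
have Vu : V \is unitarymx by apply: spectral_unitarymx.
have E : A = V^t* *m diag_mx d *m V.
  rewrite -invmx_unitary //; apply/orthomx_spectralP.
  by apply/normalmxP; rewrite posmx_herm.
split=> // i; have := posmx_diag_ge0 i (posmx_conj V Ap).
rewrite {1}E !mulmxA unitarymxK // mul1mx -mulmxA unitarymxK // mulmx1.
by rewrite mxE eqxx.
Qed.

Lemma mxsqrtE n (A : 'M[C]_n) : mxsqrt A =
  (spectralmx A)^t* *m diag_mx (map_mx sqrtC (spectral_diag A)) *m spectralmx A.
Proof.
by rewrite /mxsqrt [locked_with _ _]unlock invmx_unitary ?spectral_unitarymx.
Qed.

Lemma posmx_mxsqrt n (A : 'M[C]_n) : posmx A -> posmx (mxsqrt A).
Proof.
move=> /posmx_spectral[_ d0]; rewrite mxsqrtE; apply: posmx_unitary_diag => i.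
by rewrite mxE sqrtC_ge0.
Qed.

Lemma unitary_diag_mul n (U : 'M[C]_n) (d e : 'rV[C]_n) : U \is unitarymx ->
  (U^t* *m diag_mx d *m U) *m (U^t* *m diag_mx e *m U) =
  U^t* *m diag_mx (\row_i (d 0 i * e 0 i)) *m U.
Proof.
move=> Uu; rewrite !mulmxA mulmxtVK //; congr (_ *m _); rewrite -mulmxA.
congr (_ *m _); apply/matrixP => i j; rewrite mul_diag_mx !mxE.
by case: eqP => [->|]; rewrite ?mulr1n // !mulr0n mulr0.
Qed.

Lemma mxsqrtK n (A : 'M[C]_n) : posmx A -> mxsqrt A *m mxsqrt A = A.
Proof.
move=> /posmx_spectral[E d0]; rewrite mxsqrtE unitary_diag_mul; last first.
  exact: spectral_unitarymx.
rewrite [RHS]E; congr (_ *m diag_mx _ *m _); apply/rowP => i.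
by rewrite !mxE -expr2 sqrtCK.
Qed.

Lemma mxsqrt_herm n (A : 'M[C]_n) : posmx A -> (mxsqrt A)^t* = mxsqrt A.
Proof. by move=> /posmx_mxsqrt/posmx_herm. Qed.

(* An intertwiner of the squares of two nonnegative diagonal matrices
   intertwines the matrices themselves. *)
Lemma mxsqrt_unique n (A S : 'M[C]_n) : posmx S -> S *m S = A -> mxsqrt A = S.
Proof.
move=> Sp SA; have Ap : posmx A.
  by rewrite -SA -{2}(posmx_herm Sp); apply: posmx_gram.
have [ES s0] := posmx_spectral Sp; have [EA d0] := posmx_spectral Ap.
rewrite mxsqrtE; set V := spectralmx A in EA *; set U := spectralmx S in ES.
set d := spectral_diag A in EA d0 *; set s := spectral_diag S in ES s0.
have Vu : V \is unitarymx by apply: spectral_unitarymx.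
have Uu : U \is unitarymx by apply: spectral_unitarymx.
set e := map_mx sqrtC d.
have e0 i : 0 <= e 0 i by rewrite mxE sqrtC_ge0.
have H : diag_mx s *m (diag_mx s *m (U *m V^t* )) =
    U *m V^t* *m diag_mx e *m diag_mx e.
  have e2 : diag_mx e *m diag_mx e = diag_mx d.
    apply/matrixP => i j; rewrite mul_diag_mx !mxE.
    by case: eqP => [->|]; rewrite ?mulr1n ?mulr0n ?mulr0 // -expr2 sqrtCK.
  have <- : U *m A *m V^t* = U *m V^t* *m diag_mx e *m diag_mx e.
    by rewrite -[RHS]mulmxA e2 {1}EA !mulmxA mulmxtVK.
  by rewrite -SA ES !mulmxA mulmxtVK // unitarymxK // mul1mx.
have H' : diag_mx s *m (U *m V^t* ) = U *m V^t* *m diag_mx e.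
  apply/matrixP => i j; move/matrixP/(_ i j): H.
  move: (U *m V^t* ) => G; rewrite !mul_diag_mx !mul_mx_diag !mxE.
  have [->|Gn] := eqVneq (G i j) 0; first by rewrite !(mulr0, mul0r).
  rewrite mulrA [LHS]mulrC -[RHS]mulrA => /(mulfI Gn).
  rewrite -!expr2 => /eqP; rewrite eqrXn2 // ?sqrtC_ge0 // => /eqP ->.
  by rewrite mulrC.
transitivity (U^t* *m (U *m V^t* *m diag_mx e) *m V).
  by rewrite !mulmxA unitarymxKV // mul1mx.
by rewrite -H' ES !mulmxA mulmxKtV.
Qed.

Lemma mxtrace_gram_eq0 m n (P : 'M[C]_(m, n)) : \tr (P *m P^t* ) = 0 -> P = 0.
Proof.
move=> P0; apply/matrixP => i j; rewrite [RHS]mxE; apply/eqP.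
rewrite -mul_conjC_eq0; apply/eqP.
have pos k l : 0 <= P k l * (P k l)^* by apply: mul_conjC_ge0.
have E k : (P *m P^t* ) k k = \sum_l P k l * (P k l)^*.
  by rewrite mxE; apply: eq_bigr => l _; rewrite !mxE.
move: P0; rewrite /mxtrace => /psumr_eq0P P0.
have := P0 (fun k _ => posmx_diag_ge0 k (posmx_gram P)) i isT.
by rewrite E => /psumr_eq0P -> //.
Qed.

Lemma posmx_sqrtE n (A : 'M[C]_n) : posmx A -> A = mxsqrt A *m (mxsqrt A)^t*.
Proof. by move=> Ap; rewrite mxsqrt_herm // mxsqrtK. Qed.

Lemma posmx_tr_eq0 n (A : 'M[C]_n) : posmx A -> \tr A = 0 -> A = 0.
Proof.
move=> Ap; rewrite {1}(posmx_sqrtE Ap) => /mxtrace_gram_eq0 E.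
by rewrite (posmx_sqrtE Ap) E mul0mx.
Qed.

(** tr(A B) is the squared Hilbert-Schmidt norm of sqrt A sqrt B, so both implications pass through
    the vanishing of that product. *)
Lemma posmx_mul_eq0 n (A B : 'M[C]_n) : posmx A -> posmx B ->
  (\tr (A *m B) = 0 -> A *m B = 0) /\
  (A *m B = 0 -> mxsqrt A *m mxsqrt B = 0).
Proof.
move=> Ap Bp.
have H : \tr (A *m B) = 0 -> mxsqrt A *m mxsqrt B = 0.
  move=> AB0; apply: mxtrace_gram_eq0; rewrite -AB0 adjmxM !mxsqrt_herm //.
  rewrite !mulmxA mxtrace_mulC !mulmxA mxsqrtK // -mulmxA mxsqrtK //.
split=> [/H E|E]; last by apply: H; rewrite E mxtrace0.
rewrite -(mxsqrtK Ap) -(mxsqrtK Bp) -mulmxA [X in _ *m X]mulmxA E.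
by rewrite mul0mx mulmx0.
Qed.

Lemma posmx_tr_mul_ge0 n (A B : 'M[C]_n) :
  posmx A -> posmx B -> 0 <= \tr (A *m B).
Proof.
move=> Ap Bp; rewrite -(mxsqrtK Ap) -mulmxA mxtrace_mulC.
by rewrite -{2}(mxsqrt_herm Ap); apply/posmx_tr_ge0/posmx_conj.
Qed.

(** U diagonalizes M M^*, so the rows of U M are orthogonal with squared norms s_i^2, and
    normalizing them gives W. A row with s_i = 0 vanishes, so W is only a partial isometry; this
    form also covers rectangular M. *)
Lemma singular_values m n (M : 'M[C]_(m, n)) :
  exists (U : 'M[C]_m) (s : 'rV[C]_m) (W : 'M[C]_(m, n)),
  [/\ U \is unitarymx, forall i, 0 <= s 0 i, M = U^t* *m diag_mx s *m W &
      W *m W^t* = diag_mx (\row_i (s 0 i != 0)%:R)].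
Proof.
have [] := posmx_spectral (posmx_gram M).
set U := spectralmx _; set d := spectral_diag _ => E d0.
have Uu : U \is unitarymx by apply: spectral_unitarymx.
pose N := U *m M; pose s := map_mx sqrtC d.
have NN : N *m N^t* = diag_mx d.
  rewrite adjmxM !mulmxA -[U *m M *m _]mulmxA E !mulmxA mulmxtVK //.
  by rewrite unitarymxK // mul1mx.
have NNE i j : \sum_k N i k * (N j k)^* = d 0 i *+ (i == j).
  move/matrixP/(_ i j): NN; rewrite !mxE => <-.
  by apply: eq_bigr => k _; rewrite !mxE.
have s0 i : 0 <= s 0 i by rewrite mxE sqrtC_ge0.
have N0 i k : s 0 i = 0 -> N i k = 0.
  rewrite mxE => /eqP; rewrite sqrtC_eq0 => /eqP di.
  have := NNE i i; rewrite di eqxx => /psumr_eq0P H.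
  apply/eqP; rewrite -mul_conjC_eq0; apply/eqP/H => // l _.
  exact: mul_conjC_ge0.
have s2 i : d 0 i = s 0 i * s 0 i by rewrite mxE -expr2 sqrtCK.
have NE : N = U *m M by [].
clearbody s N; exists U, s, (\matrix_(i, k) ((s 0 i)^-1 * N i k)); split=> //.
- transitivity (U^t* *m N); first by rewrite NE mulmxA unitarymxKV // mul1mx.
  rewrite -mulmxA; congr (_ *m _); apply/matrixP => i k.
  rewrite mul_diag_mx [RHS]mxE [X in _ * X]mxE mulrA.
  have [/N0 -> | si] := eqVneq (s 0 i) 0; first by rewrite mulr0.
  by rewrite divff // mul1r.
- apply/matrixP => i j; rewrite !mxE.
  transitivity ((s 0 i)^-1 * (s 0 j)^-1 * \sum_k N i k * (N j k)^*).
    rewrite mulr_sumr; apply: eq_bigr => k _; rewrite !mxE rmorphM /= fmorphV /=.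
    by rewrite (geC0_conj (s0 j)); ring.
  rewrite NNE; have [<-|_] := eqVneq i j; last by rewrite mulr0.
  rewrite !mulr1n s2.
  have [-> | si] := eqVneq (s 0 i) 0; first by rewrite !mulr0.
  by rewrite mulrA mulfVK // mulVf.
Qed.

(** * Subpurifications and Uhlmann's theorem *)

Definition subgram m n (A : 'M[C]_m) (P : 'M[C]_(m, n)) : Prop :=
  posmx (A - P *m P^t* ).

Lemma subgram_gram m n (P : 'M[C]_(m, n)) : subgram (P *m P^t* ) P.
Proof. by rewrite /subgram subrr; apply: posmx0. Qed.

Lemma subgramZ m n a (A : 'M[C]_m) (P : 'M[C]_(m, n)) : 0 <= a ->
  subgram A P -> subgram (a ^+ 2 *: A) (a *: P).
Proof.
move=> a0 AP; rewrite /subgram adjmxZ (geC0_conj a0) -scalemxAl -scalemxAr.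
by rewrite scalerA -expr2 -scalerBr; apply: posmxZ; rewrite ?exprn_ge0.
Qed.

(** A subpurification Q of the identity is a contraction, and A - P Q Q^* P^* is the sum of A - P
    P^* and P (1 - Q Q^* ) P^*. *)
Lemma subgram_mul m n p (A : 'M[C]_m) (P : 'M[C]_(m, n)) (Q : 'M[C]_(n, p)) :
  subgram A P -> subgram 1%:M Q -> subgram A (P *m Q).
Proof.
move=> AP Q1; have := posmxD AP (posmx_conj P Q1).
rewrite mulmxBr mulmxBl mulmx1 addrA subrK /subgram adjmxM.
by rewrite !mulmxA.
Qed.

Lemma unitary_subgram n (U : 'M[C]_n) : U \is unitarymx -> subgram 1%:M U.
Proof. by move=> Uu; rewrite -(unitarymxK Uu); apply: subgram_gram. Qed.

Lemma partial_isometry_subgram m n (W : 'M[C]_(m, n)) (b : 'I_m -> bool) :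
  W *m W^t* = diag_mx (\row_i (b i)%:R) -> subgram 1%:M W.
Proof.
rewrite /subgram => ->.
have -> : 1%:M - diag_mx (\row_i (b i)%:R) =
    diag_mx (\row_i (~~ b i)%:R) :> 'M[C]_m.
  apply/matrixP => i j; rewrite !mxE; case: eqP => [->|]; last first.
    by rewrite !mulr0n subrr.
  by case: (b j); rewrite !mulr1n ?subrr ?subr0.
by apply: posmx_diag_mx => i; rewrite mxE ler0n.
Qed.

(* Douglas factorization: D completes P to a square root of A. *)
Lemma subgram_factor m n (A : 'M[C]_m) (P : 'M[C]_(m, n)) : subgram A P ->
  exists2 V, P = mxsqrt A *m V & subgram 1%:M V.
Proof.
move=> AP; pose D := mxsqrt (A - P *m P^t* ).
have AE : A = row_mx P D *m (row_mx P D)^t*.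
  rewrite tr_row_mx map_col_mx mul_row_col.
  by rewrite /D -posmx_sqrtE // addrC subrK.
have [U [s [W [Uu s0 PD WW]]]] := singular_values (row_mx P D).
have -> : mxsqrt A = U^t* *m diag_mx s *m U.
  apply: mxsqrt_unique; first exact: posmx_unitary_diag.
  rewrite AE PD !adjmxM trmxCK adjmx_diag // !mulmxA mulmxtVK //.
  congr (_ *m _); rewrite -!mulmxA; congr (_ *m _).
  rewrite [X in _ = _ *m X]mulmxA WW; apply/matrixP => i j.
  rewrite !mul_diag_mx !mxE; congr (_ * _).
  case: eqP => [->|]; last by rewrite !mulr0n mulr0.
  by case: eqP => [->|]; rewrite !mulr1n ?mul0r ?mul1r.
pose V := U^t* *m W; have V1 : subgram 1%:M V.
  apply: subgram_mul; last exact: partial_isometry_subgram WW.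
  by apply: unitary_subgram; rewrite trmxC_unitary.
have PDV : row_mx P D = (U^t* *m diag_mx s *m U) *m V.
  by rewrite PD /V !mulmxA mulmxtVK.
exists (lsubmx V).
  by rewrite -[LHS](row_mxKl P D) PDV -mulmx_lsub.
(* Dropping the right block of V adds its Gram matrix to 1 - V V^*, so the left block is still a
   contraction. *)
have := posmxD V1 (posmx_gram (rsubmx V)); rewrite /subgram -{1 2}[V]hsubmxK.
by rewrite tr_row_mx map_col_mx mul_row_col opprD addrA subrK.
Qed.

(* Read off the positive diagonal of (X - Y) (X - Y)^*. *)
Lemma Re_gram_le1 m n (X Y : 'M[C]_(m, n)) i :
  subgram 1%:M X -> subgram 1%:M Y -> 'Re ((X *m Y^t* ) i i) <= 1.
Proof.
move=> /(posmx_diag_ge0 i) X1 /(posmx_diag_ge0 i) Y1.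
have := posmx_diag_ge0 i (posmx_gram (X - Y)).
have YX : (Y *m X^t* ) i i = ((X *m Y^t* ) i i)^*.
  have -> : Y *m X^t* = (X *m Y^t* )^t* by rewrite adjmxM trmxCK.
  by rewrite !mxE.
rewrite adjmxB mulmxBl !mulmxBr.
have mxDii (M N : 'M[C]_m) : (M + N) i i = M i i + N i i by rewrite mxE.
have mxNii (M : 'M[C]_m) : (- M) i i = - M i i by rewrite mxE.
move: X1 Y1; rewrite !(mxDii, mxNii) mxE eqxx YX => X1 Y1 D0.
rewrite ReE ler_pdivrMr ?ltr0n // mul1r -subr_ge0.
have := addr_ge0 (addr_ge0 X1 Y1) D0.
by congr (0 <= _); rewrite ?mulr1n /=; ring.
Qed.

Definition mxfid n (A B : 'M[C]_n) : C :=
  \tr (mxsqrt ((mxsqrt A *m mxsqrt B)^t* *m (mxsqrt A *m mxsqrt B))).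

Lemma mxfid_ortho n (A B : 'M[C]_n) : posmx A -> posmx B ->
  A *m B = 0 -> mxfid A B = 0.
Proof.
move=> Ap Bp AB; rewrite /mxfid; have [_ /(_ AB) ->] := posmx_mul_eq0 Ap Bp.
rewrite mulmx0 (@mxsqrt_unique _ 0 0) ?mxtrace0 ?mulmx0 //; exact: posmx0.
Qed.

(** The support projection W W^* fixes diag s, so W^* diag(s) W is the positive square root of M^*
    M. *)
Lemma mxtrace_abs m (M U W : 'M[C]_m) (s : 'rV[C]_m) :
  U \is unitarymx -> (forall i, 0 <= s 0 i) -> M = U^t* *m diag_mx s *m W ->
  W *m W^t* = diag_mx (\row_i (s 0 i != 0)%:R) ->
  \tr (mxsqrt (M^t* *m M)) = \sum_i s 0 i.
Proof.
move=> Uu s0 ME WW.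
have sD : diag_mx s *m (W *m W^t* ) = diag_mx s.
  rewrite WW; apply/matrixP => i j; rewrite mul_mx_diag !mxE.
  case: eqP => [->|]; last by rewrite mulr0n mul0r.
  by case: eqP => [->|]; rewrite !mulr1n ?mulr0 ?mulr1.
rewrite (@mxsqrt_unique _ _ (W^t* *m diag_mx s *m W)).
- by rewrite -mulmxA mxtrace_mulC -mulmxA sD mxtrace_diag.
- by have := posmx_conj (W^t* ) (posmx_diag_mx s0); rewrite trmxCK.
- rewrite ME !adjmxM trmxCK adjmx_diag // !mulmxA (mulmxtVK _ Uu).
  by rewrite -(mulmxA _ W) -(mulmxA (W^t* ) (diag_mx s)) sD.
Qed.

(** After Douglas factorization with contractions V and V', cyclicity turns the trace into the sum
    of the diagonal entries of (U V) (W V')^* weighted by the singular values; [Re_gram_le1] bounds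
    the real part of each entry. *)
Lemma subgram_mxfid m n (A B : 'M[C]_m) (P Q : 'M[C]_(m, n)) :
  posmx A -> posmx B -> subgram A P -> subgram B Q ->
  'Re (\tr (P *m Q^t* )) <= mxfid A B.
Proof.
move=> Ap Bp /subgram_factor[V -> V1] /subgram_factor[V' -> V'1].
rewrite /mxfid; set M := mxsqrt A *m mxsqrt B.
have [U [s [W [Uu s0 ME WW]]]] := singular_values M.
rewrite (mxtrace_abs Uu s0 ME WW).
have -> : \tr (mxsqrt A *m V *m (mxsqrt B *m V')^t* ) =
    \sum_i ((U *m V) *m (W *m V')^t* ) i i * s 0 i.
  transitivity (\tr ((U *m V) *m (W *m V')^t* *m diag_mx s)); last first.
    by apply: eq_bigr => i _; rewrite mul_mx_diag mxE.
  have E : mxsqrt B *m mxsqrt A = W^t* *m diag_mx s *m U.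
    rewrite -(mxsqrt_herm Bp) -(mxsqrt_herm Ap) -adjmxM -/M ME.
    by rewrite !adjmxM trmxCK adjmx_diag // mulmxA.
  rewrite !adjmxM mxsqrt_herm // -!mulmxA mxtrace_mulC -!mulmxA E.
  by rewrite [RHS]mxtrace_mulC !mulmxA.
rewrite raddf_sum /= ler_sum // => i _.
rewrite mulrC ReMl ?ger0_real // -[leRHS]mulr1 ler_wpM2l //.
apply: Re_gram_le1; apply: subgram_mul => //.
  exact: unitary_subgram.
exact: partial_isometry_subgram WW.
Qed.

(** U^* W is the polar factor of sqrt A sqrt B; inserting it after sqrt A makes every singular value
    enter the trace with phase one. *)
Lemma mxfid_attained n (A B : 'M[C]_n) : posmx A -> posmx B ->
  exists2 P : 'M[C]_n, subgram A P & \tr (P *m (mxsqrt B)^t* ) = mxfid A B.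
Proof.
move=> Ap Bp; rewrite /mxfid; set M := mxsqrt A *m mxsqrt B.
have [U [s [W [Uu s0 ME WW]]]] := singular_values M.
rewrite (mxtrace_abs Uu s0 ME WW).
exists (mxsqrt A *m (U^t* *m W)).
  apply: subgram_mul; first by rewrite {1}(posmx_sqrtE Ap); apply: subgram_gram.
  apply: subgram_mul; last exact: partial_isometry_subgram WW.
  by apply: unitary_subgram; rewrite trmxC_unitary.
have E : mxsqrt B *m mxsqrt A = W^t* *m diag_mx s *m U.
  rewrite -(mxsqrt_herm Bp) -(mxsqrt_herm Ap) -adjmxM -/M ME.
  by rewrite !adjmxM trmxCK adjmx_diag // mulmxA.
rewrite mxsqrt_herm // -mulmxA mxtrace_mulC -!mulmxA E mxtrace_mulC.
rewrite -!mulmxA (unitarymxK Uu) mulmx1 [W *m _]mulmxA WW.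
apply: eq_bigr => i _; rewrite mul_diag_mx !mxE eqxx mulr1n.
by case: eqP => [->|]; rewrite ?mulr0 ?mul1r.
Qed.

Lemma mxtrace_gramC m n (P Q : 'M[C]_(m, n)) :
  \tr (Q *m P^t* ) = (\tr (P *m Q^t* ))^*.
Proof.
have -> : Q *m P^t* = (P *m Q^t* )^t* by rewrite adjmxM trmxCK.
by rewrite /mxtrace rmorph_sum; apply: eq_bigr => i _; rewrite !mxE.
Qed.

(** * Block matrices and their row blocks *)

Definition mxblk k n (Y : 'M[C]_(k * n)) (i j : 'I_k) : 'M[C]_n :=
  \matrix_(a, b) Y (mxtens_index (i, a)) (mxtens_index (j, b)).

Definition mxstrip k n m (P : 'M[C]_(k * n, m)) (i : 'I_k) : 'M[C]_(n, m) :=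
  \matrix_(a, b) P (mxtens_index (i, a)) b.

Definition mxstack k n m (P : 'I_k -> 'M[C]_(n, m)) : 'M[C]_(k * n, m) :=
  \matrix_(a, b) P (mxtens_unindex a).1 (mxtens_unindex a).2 b.

Lemma mxstackK k n m (P : 'I_k -> 'M[C]_(n, m)) i : mxstrip (mxstack P) i = P i.
Proof. by apply/matrixP => a b; rewrite !mxE mxtens_indexK. Qed.

Lemma mxblk_gram k n m (P Q : 'M[C]_(k * n, m)) i j :
  mxblk (P *m Q^t* ) i j = mxstrip P i *m (mxstrip Q j)^t*.
Proof.
by apply/matrixP => a b; rewrite !mxE; apply: eq_bigr => l _; rewrite !mxE.
Qed.

Lemma mxblkB k n (Y Z : 'M[C]_(k * n)) i j :
  mxblk (Y - Z) i j = mxblk Y i j - mxblk Z i j.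
Proof. by apply/matrixP => a b; rewrite !mxE. Qed.

Lemma sum_mxtens_index k n (F : 'I_(k * n) -> C) :
  \sum_a F a = \sum_i \sum_j F (mxtens_index (i, j)).
Proof.
rewrite pair_big /=; rewrite (reindex (@mxtens_index k n)) /=.
  by apply: eq_bigr => -[].
by exists (@mxtens_unindex k n) => a _; rewrite ?mxtens_indexK ?mxtens_unindexK.
Qed.

Lemma mxtrace_mxblk k n (Y : 'M[C]_(k * n)) : \tr Y = \sum_i \tr (mxblk Y i i).
Proof.
rewrite /mxtrace sum_mxtens_index; apply: eq_bigr => i _.
by apply: eq_bigr => a _; rewrite mxE.
Qed.

Lemma posmx_mxblk k n (Y : 'M[C]_(k * n)) i : posmx Y -> posmx (mxblk Y i i).
Proof. by move=> /posmx_sqrtE ->; rewrite mxblk_gram; apply: posmx_gram. Qed.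

Lemma subgram_mxblk k n m (Y : 'M[C]_(k * n)) (P : 'M[C]_(k * n, m)) i :
  subgram Y P -> subgram (mxblk Y i i) (mxstrip P i).
Proof. by move=> /(posmx_mxblk i); rewrite mxblkB mxblk_gram. Qed.

(** * Commuting positive matrices *)

Lemma mxfid_psd_overlap n (A B : 'M[C]_n) :
  posmx (mxsqrt A *m mxsqrt B) -> mxfid A B = \tr (mxsqrt A *m mxsqrt B).
Proof.
by move=> ABp; rewrite /mxfid (mxsqrt_unique ABp) // posmx_herm.
Qed.

Lemma mulmx_col m n p (A : 'M[C]_(m, n)) (B : 'M[C]_(n, p)) x :
  A *m col x B = col x (A *m B).
Proof. by rewrite !colE mulmxA. Qed.

Lemma eigenbasis_diag n (A U : 'M[C]_n) (d : 'rV[C]_n) : U \is unitarymx ->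
  (forall x, A *m col x U = d 0 x *: col x U) -> A = U *m diag_mx d *m U^t*.
Proof.
move=> Uu AU; have <- : A *m U = U *m diag_mx d.
  apply/matrixP => i x; have /matrixP/(_ i 0) := AU x.
  by rewrite mulmx_col mul_mx_diag !mxE mulrC.
by rewrite mulmxtVK.
Qed.

Lemma unitary_diagK n (U : 'M[C]_n) (d : 'rV[C]_n) : U \is unitarymx ->
  U^t* *m (U *m diag_mx d *m U^t* ) *m U^t*^t* = diag_mx d.
Proof.
move=> Uu; rewrite trmxCK !mulmxA unitarymxKV // mul1mx -mulmxA.
by rewrite unitarymxKV // mulmx1.
Qed.

Lemma mxsqrt_unitary_diag n (U : 'M[C]_n) (d : 'rV[C]_n) : U \is unitarymx ->
  (forall x, 0 <= d 0 x) ->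
  mxsqrt (U *m diag_mx (\row_x (d 0 x ^+ 2)) *m U^t* ) = U *m diag_mx d *m U^t*.
Proof.
move=> Uu d0; have V : U^t* \is unitarymx by rewrite trmxC_unitary.
apply: mxsqrt_unique; first exact/posmx_conj/posmx_diag_mx.
have := unitary_diag_mul d d V; rewrite trmxCK => ->.
by congr (_ *m diag_mx _ *m _); apply/rowP => x; rewrite !mxE expr2.
Qed.

(** Here sqrt A sqrt B is positive, hence its own absolute value, so the fidelity equals the overlap
    of the square roots. Writing the spectra as squares keeps roots out of the computation. *)
Lemma mxfid_unitary_diag n (U : 'M[C]_n) (d e : 'rV[C]_n) : U \is unitarymx ->
  (forall x, 0 <= d 0 x) -> (forall x, 0 <= e 0 x) ->
  let A := U *m diag_mx (\row_x (d 0 x ^+ 2)) *m U^t* in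
  let B := U *m diag_mx (\row_x (e 0 x ^+ 2)) *m U^t* in
  mxfid A B = \sum_x d 0 x * e 0 x /\
  \tr (mxsqrt A *m (mxsqrt B)^t* ) = \sum_x d 0 x * e 0 x.
Proof.
move=> Uu d0 e0 A B; have V : U^t* \is unitarymx by rewrite trmxC_unitary.
have AB : mxsqrt A *m mxsqrt B =
    U *m diag_mx (\row_x (d 0 x * e 0 x)) *m U^t*.
  rewrite !mxsqrt_unitary_diag //.
  by have := unitary_diag_mul d e V; rewrite trmxCK.
have trAB : \tr (mxsqrt A *m mxsqrt B) = \sum_x d 0 x * e 0 x.
  rewrite AB mxtrace_mulC mulmxA unitarymxKV // mul1mx mxtrace_diag.
  by apply: eq_bigr => x _; rewrite mxE.
have Bp : posmx B.
  by apply/posmx_conj/posmx_diag_mx => x; rewrite mxE exprn_ge0.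
split; last by rewrite mxsqrt_herm.
rewrite mxfid_psd_overlap // AB; apply/posmx_conj/posmx_diag_mx => x.
by rewrite mxE mulr_ge0.
Qed.

(** Joint unitary triangularization suffices, because a Hermitian triangular matrix is diagonal. *)
Lemma commuting_posmx_eigenbasis r n (A : 'I_r -> 'M[C]_n) :
  (forall i, posmx (A i)) -> (forall i j, comm_mx (A i) (A j)) ->
  exists U : 'M[C]_n, U \is unitarymx /\
    forall i x, exists2 d, 0 <= d & A i *m col x U = d *: col x U.
Proof.
move=> Ap Ac; have [] := @cotrigonalization _ _ (codom A).
  by move=> _ _ /codomP[i ->] /codomP[j ->]; apply: Ac.
move=> P Pu /allP /= PA; exists (P^t* ); rewrite trmxC_unitary; split=> // i x.
pose D := P *m A i *m P^t*; have Dp : posmx D by apply: posmx_conj.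
have /is_trig_mxP Dtrig : is_trig_mx D.
  by have := PA _ (codom_f A i); rewrite /similar_to /= conjymx.
have AP : A i *m P^t* = P^t* *m D by rewrite !mulmxA unitarymxKV // mul1mx.
clearbody D; have D0 a b : a != b -> D a b = 0.
  rewrite -val_eqE neq_ltn => /orP[|ba]; first exact: Dtrig.
  by rewrite -(posmx_herm Dp) !mxE Dtrig ?rmorph0.
exists (D x x); first exact: posmx_diag_ge0.
rewrite mulmx_col AP; apply/colP => a; rewrite mxE mxE (bigD1 x) //= big1 => [|b].
  by rewrite addr0 !mxE mulrC.
by move=> bx; rewrite (D0 b x) ?mulr0.
Qed.

Lemma mxblk_tens_sum k n (Z : 'I_k -> 'I_k -> 'M[C]_n) i j :
  mxblk (\sum_a \sum_b (delta_mx a b : 'M[C]_k) *t Z a b) i j = Z i j.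
Proof.
apply/matrixP => u v; rewrite mxE summxE (bigD1 i) //= [X in _ + X]big1 => [|a ai].
  rewrite addr0 summxE (bigD1 j) //= big1 => [|b bj].
    by rewrite addr0 tensmxE mxE !eqxx mul1r.
  by rewrite tensmxE mxE eqxx eq_sym (negPf bj) mul0r.
rewrite summxE big1 // => b _.
by rewrite tensmxE mxE eq_sym (negPf ai) mul0r.
Qed.

(** * Block-diagonal matrices, the form of classical-quantum states *)

Section BlockDiagonal.
Variables (X : finType) (n : nat).
Implicit Types (c : X -> C) (A : X -> 'M[C]_n).

Definition cqmx c A : 'M[C]_(#|X| * n) :=
  \sum_x c x *: (delta_mx (enum_rank x) (enum_rank x) *t A x).

Lemma cqmxE c A x a y b :
  cqmx c A (mxtens_index (enum_rank x, a)) (mxtens_index (enum_rank y, b)) =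
  c x * A x a b *+ (x == y).
Proof.
rewrite summxE (bigD1 x) //= big1 ?addr0 => [|z zx].
  rewrite mxE tensmxE mxE eqxx (inj_eq enum_rank_inj) eq_sym.
  by case: eqP; rewrite ?mulr1n ?mulr0n ?mul1r ?mul0r ?mulr0.
rewrite mxE tensmxE mxE (inj_eq enum_rank_inj) eq_sym (negPf zx).
by rewrite mul0r mulr0.
Qed.

Lemma mxblk_cqmx c A i :
  mxblk (cqmx c A) i i = c (enum_val i) *: A (enum_val i).
Proof.
apply/matrixP => a b; rewrite !mxE -{1 2}(enum_valK i) cqmxE eqxx.
by rewrite mulr1n.
Qed.

Lemma mxtrace_cqmx c A : \tr (cqmx c A) = \sum_x c x * \tr (A x).
Proof.
rewrite mxtrace_mxblk (reindex (@enum_rank X)) /=; last first.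
  by apply: onW_bij; apply: enum_rank_bij.
by apply: eq_bigr => x _; rewrite mxblk_cqmx enum_rankK mxtraceZ.
Qed.

Lemma cqmx_sum (I : finType) c (A : I -> X -> 'M[C]_n) :
  \sum_i cqmx c (A i) = cqmx c (fun x => \sum_i A i x).
Proof.
rewrite exchange_big; apply: eq_bigr => x _; rewrite -scaler_sumr.
congr (_ *: _); apply/matrixP => a b; rewrite summxE !mxE summxE mulr_sumr.
by apply: eq_bigr => i _; rewrite !mxE.
Qed.

Lemma cqmxB c A B : cqmx c A - cqmx c B = cqmx c (fun x => A x - B x).
Proof.
rewrite -sumrB; apply: eq_bigr => x _; rewrite -scalerBr.
by congr (_ *: _); apply/matrixP => a b; rewrite !mxE mulrBr.
Qed.

(** Block-diagonal matrices multiply blockwise. The squared weights are what lets coefficients sqrt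
    p(x) glue subpurifications of the blocks. *)
Lemma cqmx_gram c A : (forall x, 0 <= c x) ->
  cqmx c A *m (cqmx c A)^t* =
  cqmx (fun x => c x ^+ 2) (fun x => A x *m (A x)^t* ).
Proof.
move=> c0; apply/matrixP => a b.
case: (mxtens_indexP a) => i k; case: (mxtens_indexP b) => j l.
rewrite -(enum_valK i) -(enum_valK j); move: (enum_val i) (enum_val j) => x y.
rewrite cqmxE mxE sum_mxtens_index (reindex (@enum_rank X)) /=; last first.
  by apply: onW_bij; apply: enum_rank_bij.
rewrite (bigD1 x) //= [X in _ + X]big1 ?addr0 => [|z zx].
  rewrite mxE mulr_sumr -sumrMnl; apply: eq_bigr => d _.
  rewrite !mxE !cqmxE eqxx mulr1n eq_sym; case: eqP => [->|_].
    by rewrite !mulr1n rmorphM /= geC0_conj //; ring.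
  by rewrite !mulr0n rmorph0 mulr0.
apply: big1 => d _.
by rewrite cqmxE eq_sym (negPf zx) mul0r.
Qed.

Lemma posmx_cqmx c A : (forall x, 0 <= c x) -> (forall x, posmx (A x)) ->
  posmx (cqmx c A).
Proof.
move=> c0 Ap; have -> : cqmx c A =
    cqmx (fun x => sqrtC (c x) ^+ 2)
      (fun x => mxsqrt (A x) *m (mxsqrt (A x))^t* ).
  by apply: eq_bigr => x _; rewrite sqrtCK -posmx_sqrtE.
by rewrite -cqmx_gram => [|x]; [apply: posmx_gram | rewrite sqrtC_ge0].
Qed.

Lemma subgram_cqmx c A (P : X -> 'M[C]_n) : (forall x, 0 <= c x) ->
  (forall x, subgram (A x) (P x)) ->
  subgram (cqmx (fun x => c x ^+ 2) A) (cqmx c P).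
Proof.
move=> c0 AP; rewrite /subgram cqmx_gram // cqmxB; apply: posmx_cqmx => // x.
exact: exprn_ge0.
Qed.

End BlockDiagonal.

End ClosedField.

Local Open Scope complex_scope.

(** * Fidelity and secrecy *)

Section Fidelity.
Variable R : realType.
Local Notation C := R[i].

Lemma sqrtmx_mxsqrt n (A : 'M[C]_n) : sqrtmx A = mxsqrt A.
Proof. by rewrite /mxsqrt [locked_with _ _]unlock. Qed.

Lemma fidelityE n (A B : 'M[C]_n) : fidelity A B = complex.Re (mxfid A B).
Proof. by rewrite /fidelity /trace_norm !sqrtmx_mxsqrt. Qed.

Lemma ReD (x y : C) : complex.Re (x + y) = complex.Re x + complex.Re y.
Proof. by case: x; case: y. Qed.

Lemma Re_scale (a : R) (x : C) : complex.Re (a%:C * x) = a * complex.Re x.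
Proof. by case: x => u v /=; rewrite mul0r subr0. Qed.

Lemma Re_conj (x : C) : complex.Re (Num.conj x) = complex.Re x.
Proof. by case: x. Qed.

Lemma Re_ge0 (x : C) : 0 <= x -> 0 <= complex.Re x.
Proof. by rewrite lecE => /andP[]. Qed.

Lemma ge0_ReK (x : C) : 0 <= x -> x = (complex.Re x)%:C.
Proof. by move=> x0; rewrite RRe_real ?ger0_real. Qed.

(* The real Hilbert-Schmidt inner product. *)
Definition hs m n (P Q : 'M[C]_(m, n)) : R := complex.Re (\tr (P *m Q^t* )).

Lemma hsC m n (P Q : 'M[C]_(m, n)) : hs P Q = hs Q P.
Proof. by rewrite /hs mxtrace_gramC Re_conj. Qed.

Lemma hsDl m n (P P' Q : 'M[C]_(m, n)) : hs (P + P') Q = hs P Q + hs P' Q.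
Proof. by rewrite /hs mulmxDl mxtraceD ReD. Qed.

Lemma hs0l m n (Q : 'M[C]_(m, n)) : hs 0 Q = 0.
Proof. by rewrite /hs mul0mx mxtrace0. Qed.

Lemma hs_suml m n (I : finType) (P : I -> 'M[C]_(m, n)) Q :
  hs (\sum_i P i) Q = \sum_i hs (P i) Q.
Proof.
exact: (big_morph (fun P => hs P Q) (fun P P' => hsDl P P' Q) (hs0l Q)).
Qed.

Lemma hsZl m n a (P Q : 'M[C]_(m, n)) : hs (a%:C *: P) Q = a * hs P Q.
Proof. by rewrite /hs -scalemxAl mxtraceZ Re_scale. Qed.

Lemma hs_sumr m n (I : finType) (P : I -> 'M[C]_(m, n)) Q :
  hs Q (\sum_i P i) = \sum_i hs Q (P i).
Proof. by rewrite hsC hs_suml; apply: eq_bigr => i _; rewrite hsC. Qed.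

Lemma hsDr m n (P P' Q : 'M[C]_(m, n)) : hs Q (P + P') = hs Q P + hs Q P'.
Proof. by rewrite hsC hsDl !(hsC Q). Qed.

Lemma hsZr m n a (P Q : 'M[C]_(m, n)) : hs P (a%:C *: Q) = a * hs P Q.
Proof. by rewrite hsC hsZl hsC. Qed.

Lemma hs_ge0 m n (P : 'M[C]_(m, n)) : 0 <= hs P P.
Proof. exact/Re_ge0/posmx_tr_ge0/posmx_gram. Qed.

Lemma mxtrace_hs m n (P : 'M[C]_(m, n)) : \tr (P *m P^t* ) = (hs P P)%:C.
Proof. exact/ge0_ReK/posmx_tr_ge0/posmx_gram. Qed.

Lemma hs_eq0 m n (P : 'M[C]_(m, n)) : hs P P = 0 -> P = 0.
Proof. by move=> P0; apply: mxtrace_gram_eq0; rewrite mxtrace_hs P0. Qed.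

Lemma hs_sqrB m n t (P Q : 'M[C]_(m, n)) :
  hs (P + (- t)%:C *: Q) (P + (- t)%:C *: Q) =
  hs P P - 2 * t * hs P Q + t ^+ 2 * hs Q Q.
Proof. by rewrite !hsDl !hsZl !hsDr !hsZr (hsC Q P); ring. Qed.

Lemma hs_mxsqrt n (A : 'M[C]_n) : psdmx A ->
  hs (mxsqrt A) (mxsqrt A) = complex.Re (\tr A).
Proof. by move=> Ap; rewrite /hs -posmx_sqrtE. Qed.

Lemma hs_subgram_le m n (A : 'M[C]_m) (P : 'M[C]_(m, n)) :
  subgram A P -> hs P P <= complex.Re (\tr A).
Proof.
move=> /posmx_tr_ge0/Re_ge0; rewrite raddfB /= mxtrace_hs.
by case: (\tr A) => a b /=; rewrite subr_ge0.
Qed.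

Lemma fidelity_ge m n (A B : 'M[C]_m) (P Q : 'M[C]_(m, n)) :
  psdmx A -> psdmx B -> subgram A P -> subgram B Q ->
  hs P Q <= fidelity A B.
Proof.
move=> Ap Bp AP BQ; have := subgram_mxfid Ap Bp AP BQ.
by rewrite -complexRe lecE fidelityE => /andP[].
Qed.

Lemma fidelity_attained n (A B : 'M[C]_n) : psdmx A -> psdmx B ->
  exists2 P : 'M[C]_n, subgram A P & fidelity A B = hs P (mxsqrt B).
Proof.
move=> Ap Bp; have [P AP E] := mxfid_attained Ap Bp.
by exists P; rewrite // fidelityE /hs E.
Qed.

Lemma fidelity_ge0 n (A B : 'M[C]_n) : psdmx A -> psdmx B -> 0 <= fidelity A B.
Proof.
move=> Ap Bp; have S0 D : psdmx D -> subgram D (0 : 'M[C]_n).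
  by move=> Dp; rewrite /subgram mul0mx subr0.
have := fidelity_ge Ap Bp (S0 _ Ap) (S0 _ Bp).
by rewrite hs0l.
Qed.

(** For an optimal subpurification P of A, expanding the squared norm of P - sqrt B gives 0 <= 2 - 2
    F. *)
Lemma fidelity_le1 n (A B : 'M[C]_n) : is_state A -> is_state B ->
  fidelity A B <= 1.
Proof.
move=> [Ap A1] [Bp B1]; have [P /hs_subgram_le + ->] := fidelity_attained Ap Bp.
have := hs_ge0 (P + (- 1)%:C *: mxsqrt B).
by rewrite hs_sqrB hs_mxsqrt // A1 B1 /=; lra.
Qed.

(** When F = 1 the same expansion forces P = sqrt B; then A - B is positive with zero trace. *)
Lemma fidelity_eq1 n (A B : 'M[C]_n) : is_state A -> is_state B ->
  fidelity A B = 1 -> A = B.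
Proof.
move=> [Ap A1] [Bp B1]; have [P AP ->] := fidelity_attained Ap Bp => PB.
have PE : P = mxsqrt B.
  have : P + (- 1)%:C *: mxsqrt B = 0.
    apply: hs_eq0; apply/le_anti; rewrite hs_ge0 andbT hs_sqrB hs_mxsqrt //.
    by have := hs_subgram_le AP; rewrite A1 B1 PB /=; lra.
  by rewrite rmorphN rmorph1 scaleN1r => /eqP; rewrite subr_eq0 => /eqP.
move: AP; rewrite PE /subgram -posmx_sqrtE // => AB.
by apply/eqP; rewrite -subr_eq0; apply/eqP/posmx_tr_eq0;
  rewrite // raddfB /= A1 B1 subrr.
Qed.

Lemma fidelity_ortho n (A B : 'M[C]_n) : psdmx A -> psdmx B ->
  A *m B = 0 -> fidelity A B = 0.
Proof. by move=> Ap Bp AB; rewrite fidelityE mxfid_ortho. Qed.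

End Fidelity.

(** * The secrecy measure as a supremum of squared norms *)

Section Secrecy.
Variables (R : realType) (r n : nat).
Hypothesis r2 : (2 <= r)%N.
Local Notation C := R[i].
Variable rho : 'I_r -> 'M[C]_n.
Hypothesis rhoS : forall i, is_state (rho i).

Let rhoP i : psdmx (rho i). Proof. by case: (rhoS i). Qed.
Let r_gt0 : 0 < r%:R :> R. Proof. by rewrite ltr0n; case: r r2. Qed.
Let r1_gt0 : 0 < r%:R - 1 :> R. Proof. by rewrite subr_gt0 ltr1n. Qed.
Let i0 : 'I_r := Ordinal (ltnW r2).

Lemma fidelity_sum_le_secrecy sigma : is_state sigma ->
  \sum_i fidelity (rho i) sigma <= r%:R * secrecy rho.
Proof.
move=> sS; rewrite -ler_pdivrMl //; apply: ub_le_sup; last by exists sigma.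
(* The averages are bounded by 1, so [sup] does not fall back to its default value. *)
exists 1 => _ [tau tS <-]; rewrite ler_pdivrMl // mulr1.
rewrite -[leRHS]mulr1 mulrC -[r in leRHS]card_ord mulr_natr -sumr_const.
by apply: ler_sum => i _; apply: fidelity_le1.
Qed.

Lemma secrecy_le_bound c :
  (forall sigma, is_state sigma -> \sum_i fidelity (rho i) sigma <= c) ->
  r%:R * secrecy rho <= c.
Proof.
move=> H; rewrite -ler_pdivlMl //; apply: ge_sup.
  (* The state [rho i0] shows that the set of averages is nonempty. *)
  exists (r%:R^-1 * \sum_(i < r) fidelity (rho i) (rho i0)).
  by exists (rho i0); first exact: rhoS.
by move=> _ [tau tS <-]; rewrite ler_pM2l ?invr_gt0 //; apply: H.
Qed.

Lemma secrecy_ge0 : 0 <= r%:R * secrecy rho.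
Proof.
apply: le_trans (fidelity_sum_le_secrecy (rhoS i0)).
by apply: sumr_ge0 => i _; apply: fidelity_ge0.
Qed.

(** [secrecy_fidelity] is an increasing affine function of this quantity; every property except
    symmetry is reduced to a statement about it. *)
Definition total_sq : R := (r%:R * secrecy rho) ^+ 2.

Lemma secrecy_fidelityE :
  secrecy_fidelity rho = (r%:R * (r%:R - 1))^-1 * (total_sq - r%:R).
Proof.
rewrite /secrecy_fidelity /total_sq; field.
by rewrite !gt_eqF.
Qed.

(** Uhlmann writes each fidelity as the inner product of some square P_i with the same square root
    of sigma, and Cauchy-Schwarz applies to the sum of the P_i. *)
Lemma total_sq_le c :
  (forall P : 'I_r -> 'M[C]_n, (forall i, subgram (rho i) (P i)) ->
    hs (\sum_i P i) (\sum_i P i) <= c) -> total_sq <= c.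
Proof.
move=> H; have c0 : 0 <= c.
  apply: le_trans (H (fun=> 0) _); first exact: hs_ge0.
  by move=> i; rewrite /subgram mul0mx subr0; apply: rhoP.
rewrite -(sqr_sqrtr c0) lerXn2r ?nnegrE ?sqrtr_ge0 ?secrecy_ge0 //.
apply: secrecy_le_bound => sigma [sp s1].
have /choice[P HP] : forall i, exists P : 'M[C]_n, subgram (rho i) P /\
    fidelity (rho i) sigma = hs P (mxsqrt sigma).
  by move=> i; have [P] := fidelity_attained (rhoP i) sp; exists P.
rewrite (eq_bigr (fun i => hs (P i) (mxsqrt sigma))); last first.
  by move=> i _; case: (HP i).
rewrite -hs_suml; set Q := \sum_i P i; set t := hs _ _.
apply: le_trans (ler_norm _) _; rewrite -sqrtr_sqr ler_wsqrtr //.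
apply: le_trans (H P _); last by move=> i; case: (HP i).
(* Cauchy-Schwarz: sqrt sigma has norm 1 and t is its inner product with Q, so this squared norm is
   |Q|^2 - t^2. *)
have := hs_ge0 (Q + (- t)%:C *: mxsqrt sigma).
by rewrite hs_sqrB hs_mxsqrt // s1 -/t /=; lra.
Qed.

(** The normalized Q is a subpurification of the state Q Q^* / |Q|^2, so each fidelity with this
    state is at least the inner product with P_i. The number m of columns is free because
    [channel_gram] returns matrices of another width. *)
Lemma total_sq_ge m (P : 'I_r -> 'M[C]_(n, m)) :
  (forall i, subgram (rho i) (P i)) ->
  hs (\sum_i P i) (\sum_i P i) <= total_sq.
Proof.
move=> HP; set Q := \sum_i P i; set c := hs Q Q.
have c0 : 0 <= c by apply: hs_ge0.
(* If c = 0, then Q cannot be normalized, but the bound is trivial. *)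
have [->|cn] := eqVneq c 0; first exact: sqr_ge0.
pose Q' := (Num.sqrt c)^-1%:C *: Q.
have sc : Num.sqrt c ^+ 2 = c by rewrite sqr_sqrtr.
have sc0 : Num.sqrt c != 0 by rewrite sqrtr_eq0 -ltNge lt_def cn.
have sS : is_state (Q' *m Q'^t* ).
  split; first exact: posmx_gram.
  rewrite mxtrace_hs hsZl hsZr mulrA -invfM -expr2 sc -/c mulVf //.
have : Num.sqrt c <= r%:R * secrecy rho.
  apply: le_trans (fidelity_sum_le_secrecy sS).
  (* The inner products with the normalized Q add up to c / sqrt c. *)
  have -> : Num.sqrt c = \sum_i hs (P i) Q'.
    by rewrite -hs_suml hsZr -/Q -/c -{3}sc expr2 mulKf.
  apply: ler_sum => i _; apply: fidelity_ge => //; first exact: posmx_gram.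
  exact: subgram_gram.
rewrite -{2}sc => /lerXn2r -> //; first by rewrite nnegrE sqrtr_ge0.
by rewrite nnegrE secrecy_ge0.
Qed.

Lemma hs_sum_sum m (P : 'I_r -> 'M[C]_(n, m)) :
  hs (\sum_i P i) (\sum_i P i) = \sum_i \sum_j hs (P i) (P j).
Proof. by rewrite hs_suml; apply: eq_bigr => i _; rewrite hs_sumr. Qed.

(** Expand the squared norm and bound each term by Uhlmann. *)
Lemma total_sq_le_fidelity :
  total_sq <= \sum_i \sum_j fidelity (rho i) (rho j).
Proof.
apply: total_sq_le => P HP; rewrite hs_sum_sum.
by apply: ler_sum => i _; apply: ler_sum => j _; apply: fidelity_ge.
Qed.

(** The square roots of the states form an admissible family of subpurifications. *)
Lemma sum_overlap_le_total_sq :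
  \sum_i \sum_j hs (mxsqrt (rho i)) (mxsqrt (rho j)) <= total_sq.
Proof.
rewrite -hs_sum_sum; apply: total_sq_ge => i.
by rewrite {1}(posmx_sqrtE (rhoP i)); apply: subgram_gram.
Qed.

End Secrecy.

(** * Properties of the secrecy-based fidelity *)

Section Properties.
Variables (R : realType) (r : nat).
Hypothesis r2 : (2 <= r)%N.
Local Notation C := R[i].

Let r_gt0 : 0 < r%:R :> R. Proof. by rewrite ltr0n; case: r r2. Qed.
Let r1_gt0 : 0 < r%:R - 1 :> R. Proof. by rewrite subr_gt0 ltr1n. Qed.
Let rr1_gt0 : 0 < r%:R * (r%:R - 1) :> R. Proof. exact: mulr_gt0. Qed.

Lemma sum_sum_sym (g : 'I_r -> 'I_r -> R) : (forall i j, g i j = g j i) ->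
  \sum_i \sum_j g i j =
  \sum_i g i i + 2 * \sum_(i < r) \sum_(j < r | (i < j)%N) g i j.
Proof.
move=> gC; transitivity (\sum_i (g i i + (\sum_(j < r | (i < j)%N) g i j +
    \sum_(j < r | (j < i)%N) g i j))).
  apply: eq_bigr => i _; rewrite (bigD1 i) //=; congr (_ + _).
  rewrite (bigID (fun j : 'I_r => (i < j)%N)) /=; congr (_ + _);
    apply: eq_bigl => j.
    by rewrite -val_eqE /=; case: ltngtP.
  by rewrite -val_eqE /=; case: ltngtP.
rewrite !big_split /=; congr (_ + _); rewrite mulrDl mul1r; congr (_ + _).
rewrite (exchange_big_dep xpredT) //=.
by apply: eq_bigr => i _; apply: eq_bigr => j _; rewrite gC.
Qed.

Lemma state_mxsqrt_hs n (A : 'M[C]_n) : is_state A ->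
  hs (mxsqrt A) (mxsqrt A) = 1.
Proof. by move=> [Ap A1]; rewrite hs_mxsqrt // A1. Qed.

(** * Reduction to classical for commuting states *)

Section Classical.
Variables (n : nat) (rho : 'I_r -> 'M[C]_n).
Hypothesis rhoS : forall i, is_state (rho i).

Lemma commuting_eigenbasis : (forall i j, comm_mx (rho i) (rho j)) ->
  exists U lam, common_eigenbasis rho U lam.
Proof.
move=> rhoC; have [] := @commuting_posmx_eigenbasis _ _ _ rho _ rhoC.
  by move=> i; case: (rhoS i).
move=> U [Uu H]; have /choice[lam lamE] : forall i, exists l : 'I_n -> R,
    forall x, rho i *m col x U = (l x)%:C *: col x U.
  move=> i; have /choice[l lE] : forall x, exists a : R,
      rho i *m col x U = a%:C *: col x U.
    by move=> x; have [d d0 E] := H i x; exists (complex.Re d); rewrite -ge0_ReK.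
  by exists l.
by exists U, lam.
Qed.

(** The eigenvalue is a diagonal entry of the positive matrix U^* rho_i U. *)
Lemma eigenvalue_ge0 U lam : common_eigenbasis rho U lam ->
  forall i x, 0 <= lam i x.
Proof.
move=> [Uu H] i x; have [rp _] := rhoS i.
have E := @eigenbasis_diag _ _ (rho i) U (\row_x (lam i x)%:C) Uu.
have := posmx_diag_ge0 x (posmx_conj (U^t* ) rp).
rewrite E; last by move=> y; rewrite mxE.
by rewrite unitary_diagK // !mxE eqxx mulr1n ler0c.
Qed.

(** This makes the bounds [total_sq_le_fidelity] and [sum_overlap_le_total_sq] coincide. *)
Lemma eigenbasis_overlap U lam : common_eigenbasis rho U lam -> forall i j,
  fidelity (rho i) (rho j) = \sum_x Num.sqrt (lam i x * lam j x) /\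
  hs (mxsqrt (rho i)) (mxsqrt (rho j)) = \sum_x Num.sqrt (lam i x * lam j x).
Proof.
move=> Ulam; have l0 := eigenvalue_ge0 Ulam; case: Ulam => Uu H i j.
pose d k : 'rV[C]_n := \row_x (Num.sqrt (lam k x))%:C.
have d0 k x : 0 <= d k 0 x by rewrite mxE ler0c sqrtr_ge0.
have E k : rho k = U *m diag_mx (\row_x (d k 0 x ^+ 2)) *m U^t*.
  apply: eigenbasis_diag => // x; rewrite H; congr (_ *: _).
  by rewrite !mxE -rmorphXn /= sqr_sqrtr.
have S : complex.Re (\sum_x d i 0 x * d j 0 x) =
    \sum_x Num.sqrt (lam i x * lam j x).
  have -> : \sum_x d i 0 x * d j 0 x =
      (\sum_x Num.sqrt (lam i x * lam j x))%:C.
    by rewrite rmorph_sum; apply: eq_bigr => x _; rewrite !mxE -rmorphM sqrtrM.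
  by [].
have [F G] := mxfid_unitary_diag Uu (d0 i) (d0 j).
by rewrite fidelityE /hs !E F G S.
Qed.

Lemma secrecy_fidelity_classical U lam : common_eigenbasis rho U lam ->
  secrecy_fidelity rho = 2 / (r%:R * (r%:R - 1)) *
    \sum_(i < r) \sum_(j < r | (i < j)%N) \sum_(x < n)
      Num.sqrt (lam i x * lam j x).
Proof.
move=> Ulam; have O := eigenbasis_overlap Ulam.
pose g i j := \sum_x Num.sqrt (lam i x * lam j x).
have gC i j : g i j = g j i by apply: eq_bigr => x _; rewrite mulrC.
have T : total_sq rho = \sum_i \sum_j g i j.
  apply/le_anti/andP; split.
    apply: le_trans (total_sq_le_fidelity r2 rhoS) _.
    by apply: ler_sum => i _; apply: ler_sum => j _; case: (O i j) => ->.
  apply: le_trans (sum_overlap_le_total_sq r2 rhoS).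
  by apply: ler_sum => i _; apply: ler_sum => j _; case: (O i j) => _ ->.
(* The diagonal terms add up to r, which cancels the subtracted r in [secrecy_fidelityE]. *)
have gii i : g i i = 1.
  by rewrite /g; case: (O i i) => _ <-; apply: state_mxsqrt_hs.
rewrite secrecy_fidelityE // T sum_sum_sym // (eq_bigr _ (fun i _ => gii i)).
rewrite sumr_const card_ord; set S := \sum_(i < r) _.
by field; rewrite !gt_eqF.
Qed.

End Classical.

(** * Data processing *)

Section DataProcessing.
Variables (n m : nat) (N : {linear 'M[C]_n -> 'M[C]_m}).
Hypothesis Nch : is_channel N.

(** Complete positivity, applied to the Gram matrix of the stacked P_i, makes the block matrix of
    the N(P_i P_j^* ) positive; the row blocks of its square root are the Q_i. *)
Lemma channel_gram k p (P : 'I_k -> 'M[C]_(n, p)) :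
  exists Q : 'I_k -> 'M[C]_(m, k * m),
  forall i j, N (P i *m (P j)^t* ) = Q i *m (Q j)^t*.
Proof.
have [Ncp _] := Nch; have := Ncp k _ (posmx_gram (mxstack P)).
set Y := ampliation _ _ => /posmx_sqrtE YE.
exists (mxstrip (mxsqrt Y)) => i j; rewrite -mxblk_gram -YE.
transitivity (N (tens_block (mxstack P *m (mxstack P)^t* ) i j)).
  by congr (N _); rewrite -[RHS]/(mxblk _ i j) mxblk_gram !mxstackK.
by rewrite -[RHS]/(mxblk Y i j) /Y /ampliation mxblk_tens_sum.
Qed.

Lemma channel_psdmx (A : 'M[C]_n) : psdmx A -> psdmx (N A).
Proof.
move=> Ap; have [Q QE] := @channel_gram 1 _ (fun=> mxsqrt A).
have := QE 0 0; rewrite -posmx_sqrtE // => ->; exact: posmx_gram.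
Qed.

Lemma channel_state (A : 'M[C]_n) : is_state A -> is_state (N A).
Proof.
move=> [Ap A1]; split; first exact: channel_psdmx.
by case: Nch => _ ->.
Qed.

(** The Q_i of [channel_gram] have the same inner products as the P_i, since N preserves traces, and
    are subpurifications of the N(rho_i), since N is linear and positive. *)
Lemma total_sq_channel (rho : 'I_r -> 'M[C]_n) :
  (forall i, is_state (rho i)) -> total_sq rho <= total_sq (fun i => N (rho i)).
Proof.
move=> rhoS; apply: total_sq_le => // P HP.
have [Q QE] := channel_gram P.
have -> : hs (\sum_i P i) (\sum_i P i) = hs (\sum_i Q i) (\sum_i Q i).
  rewrite !hs_sum_sum; apply: eq_bigr => i _; apply: eq_bigr => j _.
  by rewrite /hs -QE; case: Nch => _ ->.
apply: total_sq_ge => // i; first exact: channel_state.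
by rewrite /subgram -QE -raddfB; apply/channel_psdmx/HP.
Qed.

Lemma secrecy_fidelity_channel (rho : 'I_r -> 'M[C]_n) :
  (forall i, is_state (rho i)) ->
  secrecy_fidelity rho <= secrecy_fidelity (fun i => N (rho i)).
Proof.
move=> rhoS; rewrite !secrecy_fidelityE // ler_wpM2l //.
  by rewrite invr_ge0 ltW.
by rewrite lerB // total_sq_channel.
Qed.

End DataProcessing.

(** The averages already agree as functions of sigma, before the supremum is taken. *)
Lemma secrecy_fidelity_perm n (rho : 'I_r -> 'M[C]_n) (s : {perm 'I_r}) :
  secrecy_fidelity rho = secrecy_fidelity (fun i => rho (s i)).
Proof.
have sumE (f : 'I_r -> R) : \sum_i f i = \sum_i f (s i).
  exact: (reindex_inj (@perm_inj _ s)).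
have E : (fun sigma => r%:R^-1 * \sum_(i < r) fidelity (rho i) sigma) =
    (fun sigma => r%:R^-1 * \sum_(i < r) fidelity (rho (s i)) sigma).
  apply: funext => sigma; apply: (congr1 (fun x => r%:R^-1 * x)).
  exact: (sumE (fun i => fidelity (rho i) sigma)).
rewrite /secrecy_fidelity /secrecy; apply: (congr1 (fun f =>
  (r%:R - 1)^-1 * (r%:R * (sup [set f x | x in _]%classic) ^+ 2 - 1))).
exact: E.
Qed.

Lemma sum_sum_const (a : R) : \sum_(i < r) \sum_(j < r) a = r%:R ^+ 2 * a.
Proof.
rewrite !sumr_const !card_ord -[a *+ r *+ r]mulr_natr -[a *+ r]mulr_natr.
by ring.
Qed.

Lemma le_sum_offdiag (g : 'I_r -> 'I_r -> R) i j :
  (forall k l, 0 <= g k l) -> j != i ->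
  g i j <= \sum_k \sum_(l | l != k) g k l.
Proof.
move=> g0 ji; rewrite (bigD1 i) //= (bigD1 j) //= -addrA lerDl addr_ge0 //.
  by apply: sumr_ge0.
by apply: sumr_ge0 => k _; apply: sumr_ge0.
Qed.

(** * Faithfulness and orthogonality *)

Section States.
Variables (n : nat) (rho : 'I_r -> 'M[C]_n).
Hypothesis rhoS : forall i, is_state (rho i).

Let rhoP i : psdmx (rho i). Proof. by case: (rhoS i). Qed.

(** The value 1 means that [total_sq] is r^2. The upper bound has r^2 fidelities, each at most 1, so
    all of them are then 1; for equal states the lower bound already gives r^2. *)
Lemma secrecy_fidelity_eq1 :
  secrecy_fidelity rho = 1 <-> forall i j, rho i = rho j.
Proof.
have -> : (secrecy_fidelity rho = 1) <-> (total_sq rho = r%:R ^+ 2).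
  have k0 : r%:R * (r%:R - 1) != 0 :> R by rewrite gt_eqF.
  rewrite secrecy_fidelityE //; split=> [/(congr1 ( *%R (r%:R * (r%:R - 1))))|->].
    by rewrite mulVKf // mulr1 => /eqP; rewrite subr_eq => /eqP ->; ring.
  by rewrite (_ : r%:R ^+ 2 - r%:R = r%:R * (r%:R - 1)) ?mulVf //; ring.
have F1 i j : fidelity (rho i) (rho j) <= 1 by apply: fidelity_le1.
have T_le : \sum_i \sum_j fidelity (rho i) (rho j) <= r%:R ^+ 2.
  rewrite -[leRHS]mulr1 -sum_sum_const.
  by apply: ler_sum => i _; apply: ler_sum => j _.
split=> [TE i j|E].
  apply: fidelity_eq1 => //; apply/eqP; rewrite eq_sym -subr_eq0; apply/eqP.
  have : \sum_i \sum_j (1 - fidelity (rho i) (rho j)) = 0.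
    rewrite (eq_bigr (fun i => \sum_(j < r) 1 - \sum_j fidelity (rho i) (rho j))).
      rewrite sumrB sum_sum_const mulr1; apply/eqP; rewrite subr_eq0 eq_le T_le.
      by rewrite -TE total_sq_le_fidelity.
    by move=> k _; rewrite sumrB.
  have G0 k l : 0 <= 1 - fidelity (rho k) (rho l) by rewrite subr_ge0.
  move=> H; have Hi : \sum_j (1 - fidelity (rho i) (rho j)) = 0.
    by apply: (psumr_eq0P _ H) => // k _; apply: sumr_ge0.
  by apply: (psumr_eq0P _ Hi) => // l _.
apply/le_anti/andP; split.
  exact: le_trans (total_sq_le_fidelity r2 rhoS) T_le.
apply: le_trans (sum_overlap_le_total_sq r2 rhoS).
rewrite -[leLHS]mulr1 -sum_sum_const.
by apply: ler_sum => i _; apply: ler_sum => j _; rewrite (E j i) state_mxsqrt_hs.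
Qed.

Lemma hs_mxsqrt_ge0 (A B : 'M[C]_n) : psdmx A -> psdmx B ->
  0 <= hs (mxsqrt A) (mxsqrt B).
Proof.
move=> Ap Bp; rewrite /hs mxsqrt_herm //.
exact/Re_ge0/(posmx_tr_mul_ge0 (posmx_mxsqrt Ap) (posmx_mxsqrt Bp)).
Qed.

Lemma hs_mxsqrt_eq0 (A B : 'M[C]_n) : psdmx A -> psdmx B ->
  hs (mxsqrt A) (mxsqrt B) = 0 -> A *m B = 0.
Proof.
move=> Ap Bp; rewrite /hs mxsqrt_herm // => H.
have Ap' := posmx_mxsqrt Ap; have Bp' := posmx_mxsqrt Bp.
have [] := posmx_mul_eq0 Ap' Bp'.
(* [hs] records only the real part, but the trace of a product of positive matrices is real, so the
   trace itself is zero. *)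
rewrite (ge0_ReK (posmx_tr_mul_ge0 Ap' Bp')) H => /(_ erefl) E _.
rewrite -(mxsqrtK Ap) -(mxsqrtK Bp) -mulmxA [X in _ *m X]mulmxA E.
by rewrite mul0mx mulmx0.
Qed.

(** The value 0 means that [total_sq] is r. The diagonal of the lower bound alone contributes r, so
    the nonnegative off-diagonal overlaps vanish. Conversely, orthogonality kills the off-diagonal
    fidelities of the upper bound. *)
Lemma secrecy_fidelity_eq0 :
  secrecy_fidelity rho = 0 <-> forall i j, i != j -> rho i *m rho j = 0.
Proof.
have -> : (secrecy_fidelity rho = 0) <-> (total_sq rho = r%:R).
  rewrite secrecy_fidelityE //; split=> [/eqP|->]; last by rewrite subrr mulr0.
  by rewrite mulf_eq0 invr_eq0 gt_eqF //= subr_eq0 => /eqP.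
pose g i j := hs (mxsqrt (rho i)) (mxsqrt (rho j)).
have g0 i j : 0 <= g i j by apply: hs_mxsqrt_ge0.
have split_diag (h : 'I_r -> 'I_r -> R) :
    \sum_i \sum_j h i j = \sum_i h i i + \sum_i \sum_(j | j != i) h i j.
  by rewrite -big_split; apply: eq_bigr => i _; rewrite (bigD1 i).
have sum1 : \sum_(i < r) 1 = r%:R :> R by rewrite sumr_const card_ord.
have Tge : r%:R + \sum_i \sum_(j | j != i) g i j <= total_sq rho.
  rewrite -sum1 -(eq_bigr _ (fun i _ => state_mxsqrt_hs (rhoS i))).
  by rewrite -(split_diag g); apply: sum_overlap_le_total_sq.
split=> [TE i j ij|rho0].
  apply: hs_mxsqrt_eq0 => //; rewrite -/(g i j); apply/le_anti.
  rewrite g0 andbT; move: Tge; rewrite TE gerDl; apply: le_trans.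
  by apply: le_sum_offdiag => //; rewrite eq_sym.
apply/le_anti/andP; split; last first.
  apply: le_trans Tge; rewrite lerDl.
  by apply: sumr_ge0 => k _; apply: sumr_ge0.
apply: le_trans (total_sq_le_fidelity r2 rhoS) _.
rewrite split_diag [X in _ + X]big1 ?addr0 => [|i _].
  by rewrite -sum1; apply: ler_sum => i _; apply: fidelity_le1.
by apply: big1 => j ji; apply: fidelity_ortho => //; apply: rho0; rewrite eq_sym.
Qed.

(** Rescaling by 1 / sqrt c reduces to [total_sq_ge]; for c = 0 every P_i is zero. This serves the
    blocks p(x) rho_i^x, where p(x) may vanish. *)
Lemma total_sq_ge_scaled m (c : R) (P : 'I_r -> 'M[C]_(n, m)) : 0 <= c ->
  (forall i, subgram (c%:C *: rho i) (P i)) ->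
  hs (\sum_i P i) (\sum_i P i) <= c * total_sq rho.
Proof.
move=> c0 HP; have [cE|cn] := eqVneq c 0.
  rewrite big1 ?hs0l ?cE ?mul0r // => i _; apply: hs_eq0.
  apply/le_anti; rewrite hs_ge0 andbT; apply: le_trans (hs_subgram_le (HP i)) _.
  by rewrite cE scale0r mxtrace0.
pose a := (Num.sqrt c)^-1; have a2 : a ^+ 2 * c = 1.
  by rewrite exprVn sqr_sqrtr // mulVf.
have HP' i : subgram (rho i) (a%:C *: P i).
  have -> : rho i = a%:C ^+ 2 *: (c%:C *: rho i).
    by rewrite scalerA -rmorphXn -rmorphM /= a2 rmorph1 scale1r.
  by apply: subgramZ => //; rewrite ler0c invr_ge0 sqrtr_ge0.
have := total_sq_ge r2 rhoS HP'; rewrite -scaler_sumr hsZl hsZr mulrA -expr2.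
move=> H; rewrite -[leLHS]mul1r -a2 mulrAC mulrC ler_wpM2l //.
Qed.

End States.

(** * The direct-sum property *)

Section DirectSum.
Variables (n : nat) (X : finType) (p : X -> R) (rho : 'I_r -> X -> 'M[C]_n).
Hypothesis pD : is_distribution p.
Hypothesis rhoS : forall i x, is_state (rho i x).

Let p0 x : 0 <= p x. Proof. by case: pD. Qed.
Let rhox x := fun i => rho i x.
Let rhoxS x i : is_state (rhox x i). Proof. exact: rhoS. Qed.

Lemma cq_stateE i : cq_state p (rho i) = cqmx (fun x => (p x)%:C) (rho i).
Proof. by []. Qed.

Lemma cq_state_state i : is_state (cq_state p (rho i)).
Proof.
split; first by apply: posmx_cqmx => x; [rewrite ler0c | case: (rhoS i x)].
rewrite cq_stateE mxtrace_cqmx; case: pD => _ p1; rewrite -[RHS]/(1%:C) -p1.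
rewrite rmorph_sum; apply: eq_bigr => x _.
by case: (rhoS i x) => _ ->; rewrite mulr1.
Qed.

(** Row block x of P_i is a subpurification of p(x) rho_i^x, and squared norms add over row
    blocks. *)
Lemma total_sq_cq_le :
  total_sq (fun i => cq_state p (rho i)) <= \sum_x p x * total_sq (rhox x).
Proof.
apply: total_sq_le => // [i|P HP]; first exact: cq_state_state.
set Q := \sum_i P i.
have -> : hs Q Q = \sum_k hs (mxstrip Q k) (mxstrip Q k).
  rewrite /hs mxtrace_mxblk (big_morph _ (@ReD R) (erefl : complex.Re 0 = 0)).
  by apply: eq_bigr => k _; rewrite mxblk_gram.
rewrite (reindex (@enum_rank X)) /=; last first.
  by apply: onW_bij; apply: enum_rank_bij.
apply: ler_sum => x _.
have -> : mxstrip Q (enum_rank x) = \sum_i mxstrip (P i) (enum_rank x).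
  by apply/matrixP => a b; rewrite mxE !summxE; apply: eq_bigr => i _; rewrite mxE.
apply: total_sq_ge_scaled => // i.
have := subgram_mxblk (enum_rank x) (HP i).
by rewrite cq_stateE mxblk_cqmx enum_rankK.
Qed.

(** Subpurifications of the rho_i^x, weighted by sqrt p(x), assemble block-diagonally. As [total_sq]
    comes from a supremum, the families are chosen optimal up to e. *)
Lemma total_sq_cq_ge :
  \sum_x p x * total_sq (rhox x) <= total_sq (fun i => cq_state p (rho i)).
Proof.
apply/ler_addgt0Pr => e e0.
have /choice[P HP] : forall x, exists P : 'I_r -> 'M[C]_n,
    (forall i, subgram (rho i x) (P i)) /\
    total_sq (rhox x) - e <= hs (\sum_i P i) (\sum_i P i).
  (* If no such family existed, [total_sq_le] would bound [total_sq] by itself minus e. *)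
  move=> x; apply: contrapT => H.
  have : total_sq (rhox x) <= total_sq (rhox x) - e.
    apply: total_sq_le => // P HP; rewrite leNgt; apply/negP => /ltW HT.
    by apply: H; exists P.
  by rewrite lerBrDr gerDl leNgt e0.
pose c x : C := (Num.sqrt (p x))%:C.
have c0 x : 0 <= c x by rewrite ler0c sqrtr_ge0.
have c2 x : c x ^+ 2 = (p x)%:C by rewrite -rmorphXn /= sqr_sqrtr.
have := @total_sq_ge _ _ _ r2 _ cq_state_state _
  (fun i => cqmx c (fun x => P x i)).
have -> : \sum_i cqmx c (fun x => P x i) = cqmx c (fun x => \sum_i P x i).
  exact: cqmx_sum.
have -> : hs (cqmx c (fun x => \sum_i P x i)) (cqmx c (fun x => \sum_i P x i)) =
    \sum_x p x * hs (\sum_i P x i) (\sum_i P x i).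
  rewrite /hs cqmx_gram // mxtrace_cqmx.
  rewrite (big_morph _ (@ReD R) (erefl : complex.Re 0 = 0)).
  by apply: eq_bigr => x _; rewrite c2 Re_scale.
move=> H; rewrite -lerBlDr; apply: le_trans (H _); last first.
  move=> i; have := @subgram_cqmx _ _ _ c (rho i) (fun x => P x i) c0.
  have -> : cqmx (fun x => c x ^+ 2) (rho i) = cq_state p (rho i).
    by apply: eq_bigr => x _; rewrite c2.
  by apply=> x; case: (HP x).
have -> : e = \sum_x p x * e by case: pD => _ p1; rewrite -mulr_suml p1 mul1r.
rewrite -sumrB; apply: ler_sum => x _; rewrite -mulrBr ler_wpM2l //.
by case: (HP x).
Qed.

Lemma secrecy_fidelity_cq :
  secrecy_fidelity (fun i => cq_state p (rho i)) =
  \sum_x p x * secrecy_fidelity (fun i => rho i x).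
Proof.
rewrite secrecy_fidelityE //.
have -> : total_sq (fun i => cq_state p (rho i)) =
    \sum_x p x * total_sq (rhox x).
  by apply/le_anti; rewrite total_sq_cq_le total_sq_cq_ge.
(* Since p sums to 1, the constant of the affine formula is averaged along with [total_sq]. *)
have rE : r%:R = \sum_x p x * r%:R :> R.
  by case: pD => _ p1; rewrite -mulr_suml p1 mul1r.
rewrite [X in _ * (_ - X)]rE -sumrB mulr_sumr; apply: eq_bigr => x _.
by rewrite secrecy_fidelityE // -mulrBr [RHS]mulrCA.
Qed.

End DirectSum.
End Properties.

Theorem mainTheorem9 (R : realType) (r : nat) (hr : (2 <= r)%N) :
  (forall (n : nat) (rho : 'I_r -> 'M[R[i]]_n),
    (forall i, is_state (rho i)) ->
    (* (i) reduction to classical *)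
    ((forall i j, comm_mx (rho i) (rho j)) ->
      (exists U lam, common_eigenbasis rho U lam) /\
      (forall (U : 'M[R[i]]_n) (lam : 'I_r -> 'I_n -> R),
        common_eigenbasis rho U lam ->
        secrecy_fidelity rho =
          2 / (r%:R * (r%:R - 1)) *
          \sum_(i < r) \sum_(j < r | (i < j)%N) \sum_(x < n)
            Num.sqrt (lam i x * lam j x))) /\
    (* (ii) data processing *)
    (forall (m : nat) (N : {linear 'M[R[i]]_n -> 'M[R[i]]_m}),
      is_channel N ->
      secrecy_fidelity rho <= secrecy_fidelity (fun i => N (rho i))) /\
    (* (iii) symmetry *)
    (forall s : {perm 'I_r},
      secrecy_fidelity rho = secrecy_fidelity (fun i => rho (s i))) /\
    (* (iv) faithfulness *)
    (secrecy_fidelity rho = 1 <-> forall i j, rho i = rho j) /\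
    (* (v) orthogonality *)
    (secrecy_fidelity rho = 0 <->
      forall i j, i != j -> rho i *m rho j = 0)) /\
  (* (vi) direct-sum property *)
  (forall (n : nat) (X : finType) (p : X -> R)
      (rho : 'I_r -> X -> 'M[R[i]]_n),
    is_distribution p ->
    (forall i x, is_state (rho i x)) ->
    secrecy_fidelity (fun i => cq_state p (rho i)) =
      \sum_x p x * secrecy_fidelity (fun i => rho i x)).
Proof.
split=> [n rho rhoS|n X p rho pD rhoS]; last exact: secrecy_fidelity_cq.
split=> [rhoC|].
  split; first exact: commuting_eigenbasis.
  by move=> U lam; apply: secrecy_fidelity_classical.
split=> [m N Nch|]; first exact: secrecy_fidelity_channel.
split; first exact: secrecy_fidelity_perm.
by split; [apply: secrecy_fidelity_eq1 | apply: secrecy_fidelity_eq0].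
Qed.
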